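(* Let $n\ge 2$, let $a_0,a_1,\ldots,a_n$ be nonnegative integers, put $a=a_1+\cdots+a_n$, and let $r,t$ be fixed integers with $1\le t<r\le n$. Then $$\mathop{\mathrm{CT}}_{\mathbf{x}}\frac{x_r^2}{x_0x_t}\,D_n(\mathbf{x},\mathbf{a},q)=q^{\widetilde{L}(r,t)}\left(\frac{(1-q^{a_0})(1-q^{a_t})\Big((1-q^{a_0+a+1})+q^{a_t}(1-q^{a+1-a_t})\Big)}{(1-q^{a+1-a_t})(1-q^{a+1})(1-q^{a_0+a+1-a_t})}\right)\frac{(q)_{a+a_0}}{(q)_{a_0}(q)_{a_1}\cdots(q)_{a_n}},$$ where $\widetilde{L}(r,t)=2\sum_{k=t+1}^{r-1}a_k+\sum_{k=1}^{t-1}a_k$.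
   Context: Here $q$ is an indeterminate, $\mathbf{x}=(x_0,\ldots,x_n)$, $\mathbf{a}=(a_0,\ldots,a_n)$, and $(z)_k=(1-z)(1-zq)\cdots(1-zq^{k-1})$ for integers $k\ge 0$. The $q$-Dyson product is $$D_n(\mathbf{x},\mathbf{a},q)=\prod_{0\le i<j\le n}\left(\frac{x_i}{x_j}\right)_{a_i}\left(\frac{x_j}{x_i}q\right)_{a_j}.$$ $\mathop{\mathrm{CT}}_{\mathbf{x}}F(\mathbf{x})$ denotes the constant term of $F$ in the variables $x_0,\ldots,x_n$. Note that $a$ does not include $a_0$. *)

(* Defs.v *)
From mathcomp Require Import all_boot all_order all_algebra fraction.
From mathcomp Require Import mpoly.
From Stdlib Require Import ClassicalEpsilon.
Set Implicit Arguments.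
Unset Strict Implicit.
Unset Printing Implicit Defensive.
Import GRing.Theory.
Local Open Scope ring_scope.

(* The field F(q) of rational functions in the indeterminate q. *)
Notation Fq F := {fraction {poly F}}.
Definition qvar (F : fieldType) : Fq F := tofrac 'X.

(* (z)_k = (1 - z)(1 - z q) ... (1 - z q^(k-1)), in any ring containing q. *)
Definition qpoch (R : comNzRingType) (q z : R) (k : nat) : R :=
  \prod_(i < k) (1 - z * q ^+ i).

Section Laurent.
Variables (K : fieldType) (n : nat).

(* The field K(x_0, ..., x_n), which contains the Laurent polynomials. *)
Local Notation ratfun := {fraction {mpoly K[n.+1]}}.

Definition xvar (i : 'I_n.+1) : ratfun := tofrac 'X_i.
Definition cst (c : K) : ratfun := tofrac c%:MP.

(* A Laurent polynomial is some P / x^m with P a polynomial and x^m a monomial;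
   its constant term is the coefficient of x^m in P. *)
Definition is_CT (f : ratfun) (c : K) : Prop :=
  exists (P : {mpoly K[n.+1]}) (m : 'X_{1..n.+1}),
    f = tofrac P / tofrac 'X_[m] /\ c = P@_m.

(* The value is irrelevant if f is not a Laurent polynomial. *)
Definition CT (f : ratfun) : K := epsilon (inhabits 0) (is_CT f).

Lemma tofracX_neq0 (m : 'X_{1..n.+1}) :
  tofrac ('X_[m] : {mpoly K[n.+1]}) != 0.
Proof.
rewrite tofrac_eq0; apply/eqP => /(congr1 (mcoeff m)) /eqP.
by rewrite mcoeffX eqxx mcoeff0 oner_eq0.
Qed.

Lemma is_CT_inj f c d : is_CT f c -> is_CT f d -> c = d.
Proof.
move=> [P [m [-> ->]]] [Q [k [E ->]]].
move/eqP: E; rewrite eqr_div ?tofracX_neq0 // -!tofracM tofrac_eq => /eqP E.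
have := congr1 (mcoeff (k + m)%MM) E.
by rewrite mcoeffMX addmC mcoeffMX.
Qed.

Lemma CT_P f c : is_CT f c -> CT f = c.
Proof.
move=> fc; apply: (@is_CT_inj f) => //.
by apply: (epsilon_spec (inhabits 0) (is_CT f)); exists c.
Qed.

Lemma CTE (P : {mpoly K[n.+1]}) (m : 'X_{1..n.+1}) :
  CT (tofrac P / tofrac 'X_[m]) = P@_m.
Proof. by apply: CT_P; exists P, m. Qed.

Definition qDyson (q : K) (a : 'I_n.+1 -> nat) : ratfun :=
  \prod_(i < n.+1) \prod_(j < n.+1 | (i < j)%N)
    (qpoch (cst q) (xvar i / xvar j) (a i) *
     qpoch (cst q) (xvar j / xvar i * cst q) (a j)).

(* Every qDyson times a quotient of monomials is a Laurent polynomial, so that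
   its CT is meaningful. *)
Definition is_laurent (f : ratfun) : Prop := exists c, is_CT f c.

Lemma is_laurent_tofrac (P : {mpoly K[n.+1]}) (m : 'X_{1..n.+1}) :
  is_laurent (tofrac P / tofrac 'X_[m]).
Proof. by exists P@_m, P, m. Qed.

Lemma is_laurent_poly (P : {mpoly K[n.+1]}) : is_laurent (tofrac P).
Proof.
by have := is_laurent_tofrac P 0%MM; rewrite mpolyX0 tofrac1 divr1.
Qed.

Lemma is_laurentM f g : is_laurent f -> is_laurent g -> is_laurent (f * g).
Proof.
move=> [_ [P [m [-> _]]]] [_ [Q [k [-> _]]]].
by rewrite mulf_div -!tofracM -mpolyXD; exact: is_laurent_tofrac.
Qed.

Lemma is_laurentB f g : is_laurent f -> is_laurent g -> is_laurent (f - g).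
Proof.
move=> [_ [P [m [-> _]]]] [_ [Q [k [-> _]]]].
rewrite -mulNr addf_div ?tofracX_neq0 // mulNr -!tofracM -tofracB -mpolyXD.
exact: is_laurent_tofrac.
Qed.

Lemma is_laurent1 : is_laurent 1.
Proof. by rewrite -tofrac1; exact: is_laurent_poly. Qed.

Lemma is_laurent_xvar i : is_laurent (xvar i).
Proof. exact: is_laurent_poly. Qed.

Lemma is_laurent_xvarV i : is_laurent (xvar i)^-1.
Proof.
by have := is_laurent_tofrac 1 U_(i); rewrite tofrac1 div1r.
Qed.

Lemma is_laurent_prod (I : Type) (s : seq I) (p : pred I) (G : I -> ratfun) :
  (forall i, is_laurent (G i)) -> is_laurent (\prod_(i <- s | p i) G i).
Proof.
by move=> lG; apply: big_ind => // [|f g]; [exact: is_laurent1|exact: is_laurentM].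
Qed.

Lemma is_laurent_qpoch q z k :
  is_laurent z -> is_laurent (qpoch (cst q) z k).
Proof.
move=> lz; apply: is_laurent_prod => i; apply: is_laurentB is_laurent1 _.
by apply: is_laurentM => //; rewrite -tofracXn; exact: is_laurent_poly.
Qed.

Lemma is_laurent_qDyson q a : is_laurent (qDyson q a).
Proof.
do 2!apply: is_laurent_prod => ?.
apply: is_laurentM; apply: is_laurent_qpoch; last apply: is_laurentM;
  try exact: is_laurent_poly.
all: by apply: is_laurentM; [exact: is_laurent_xvar|exact: is_laurent_xvarV].
Qed.

End Laurent.

Arguments xvar : clear implicits.

(* Main.v *)
Require Import Defs.
From mathcomp Require Import all_boot all_order all_algebra fraction.
From mathcomp Require Import mpoly.
From mathcomp Require Import perm ring zify.
Import GRing.Theory.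
Local Open Scope ring_scope.

(** Clearing denominators, the q-Dyson product becomes the homogeneous
    polynomial F, the product of the x_j - q^(u + [j < i]) x_i over i <> j and
    u < a_i, divided by a monomial ([qDyson_tofrac]); the constant term sought is
    then a coefficient of x_r^2 F, at a monomial x^d of the same total degree.
    Lagrange interpolation in each variable expresses such a coefficient by the
    values of the polynomial at the points (q^c_0, ..., q^c_n) with c_i <= d_i
    ([grid_coef]).  Only the terms of top degree matter on the coefficient side,
    so x_r^2 may be completed by lower terms and by multiples of other forms
    whose coefficients are known, so as to make the values vanish
    ([top_form_coef]).

    The point of evaluating at powers of q is that F is nonzero at q^c only if
    the intervals [c_i, c_i + a_i) are pairwise disjoint, with a free cell between
    two of them if the one of larger index comes first.  The box c_i <= d_i is
    hardly longer than the total length sigma of the intervals, so very few such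
    packings exist.  When c_i + a_i <= sigma for all i there is only one, the
    tiling by increasing index ([packing]); this gives the q-Dyson theorem itself
    ([qDyson_coef]).

    For x_r^2 / (x_0 x_t) the bounds on c_0 and c_t are one larger.  If t = 1,
    four packings survive ([second_layer_points]).  Some quadratic polynomial in
    x_0, x_t, x_r with leading form x_r^2 - kappa x_0 x_t vanishes at the four
    points, hence the constant term is kappa times the q-Dyson constant term
    ([second_layer_base]).

    If t > 1, the number of packings grows exponentially with t; instead x_t is
    moved towards x_0, one neighbour k at a time.  Exchanging k and t in the
    order of the variables turns F into a polynomial F', and multiplies the
    constant term by q^a_k ([second_layer_swap]): indeed q^a_k F - F' is
    divisible by x_t, which removes the enlarged bound on c_t, and the quotient
    then has packings with only two values of c_r, at which x_r^2 can be
    completed to a vanishing quadratic. *)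

(** * Coefficients by interpolation at powers of q *)

Section Interpolation.
Context {K : fieldType} (q : K).

(** The inverse of the derivative of prod_(u <= d) (X - q^u) at its root q^v. *)
Definition lagrange_weight (d v : nat) : K :=
  (\prod_(u < d.+1 | u != v :> nat) (q ^+ v - q ^+ u))^-1.

Hypothesis q_inj : injective (fun k : nat => q ^+ k).

(** Lagrange interpolation at d + 1 nodes recovers a polynomial of degree at
    most d; this is its coefficient of X^d. *)
Lemma lagrange_coef (d : nat) (p : {poly K}) : (size p <= d.+1)%N ->
  p`_d = \sum_(v < d.+1) p.[q ^+ v] * lagrange_weight d v.
Proof.
move=> sp.
pose L (v : 'I_d.+1) : {poly K} := \prod_(u < d.+1 | u != v) ('X - (q ^+ u)%:P).
have Lmon v : L v \is monic by apply: monic_prod_XsubC.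
have Lsize v : size (L v) = d.+1.
  rewrite /L -big_filter size_prod_XsubC.
  congr S; transitivity #|predC1 v|; last by rewrite cardC1 card_ord.
  by rewrite cardE /enum_mem.
have Leval (v u : 'I_d.+1) : (L v).[q ^+ u] = if u == v then (lagrange_weight d v)^-1 else 0.
  rewrite /L horner_prod; case: eqVneq => [->|ne].
    by rewrite invrK; apply: eq_bigr => w _; rewrite !hornerE.
  by rewrite (bigD1 u) //= !hornerE subrr mul0r.
have w0 (v : 'I_d.+1) : lagrange_weight d v != 0.
  rewrite invr_eq0; apply/prodf_neq0 => u ne; rewrite subr_eq0.
  by apply: contraNneq ne => /q_inj ->.
have -> : p = \sum_(v < d.+1) (p.[q ^+ v] * lagrange_weight d v) *: L v.
  apply/eqP; rewrite -subr_eq0; apply/eqP.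
  apply: (@roots_geq_poly_eq0 _ _ [seq q ^+ val v | v : 'I_d.+1]).
  - apply/allP => _ /mapP[u _ ->]; rewrite rootE !hornerE horner_sum subr_eq0.
    rewrite (bigD1 u) //= hornerZ Leval eqxx -mulrA divff // mulr1.
    rewrite big1 ?addr0 // => v ne.
    by rewrite hornerZ Leval eq_sym (negPf ne) mulr0.
  - by rewrite map_inj_uniq ?enum_uniq // => u v /q_inj /val_inj.
  - rewrite size_map size_enum_ord (leq_trans (size_polyD _ _)) // geq_max sp.
    rewrite size_polyN (leq_trans (size_sum _ _ _)) //.
    by apply/bigmax_leqP => v _; rewrite (leq_trans (size_scale_leq _ _)) ?Lsize.
rewrite coef_sum; apply: eq_bigr => v _.
have Lcoef (u : 'I_d.+1) : (L u)`_d = 1.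
  by have /monicP := Lmon u; rewrite lead_coefE Lsize.
rewrite coefZ Lcoef mulr1; congr (_ * _).
rewrite horner_sum (bigD1 v) //= hornerZ Leval eqxx -mulrA divff // mulr1.
rewrite big1 ?addr0 // => u ne.
by rewrite hornerZ Leval eq_sym (negPf ne) mulr0.
Qed.

(** The weights kill the powers below d, which is what makes the coefficient
    extraction blind to every other monomial in [grid_coef]. *)
Lemma lagrange_moment (d k : nat) : (k <= d)%N ->
  \sum_(v < d.+1) (q ^+ v) ^+ k * lagrange_weight d v = (k == d)%:R.
Proof.
move=> kd; have := @lagrange_coef d 'X^k.
rewrite size_polyXn ltnS coefXn eq_sym => /(_ kd) ->.
by apply: eq_bigr => v _; rewrite hornerXn.
Qed.

Context {n : nat}.

Lemma mnm_lt_of_mdeg (m d : 'X_{1..n}) : (mdeg m <= mdeg d)%N -> m != d ->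
  exists i, (m i < d i)%N.
Proof.
move=> md ne; apply/existsP; apply: contraR ne.
rewrite negb_exists => /forallP h.
have dm : (d <= m)%MM by apply/mnm_lepP => i; rewrite leqNgt h.
rewrite -(submK dm) -{3}[d]add0m eqm_add2r -mdeg_eq0 -leqn0.
by rewrite -(leq_add2r (mdeg d)) -mdegD submK.
Qed.

(** The coefficient form of the Combinatorial Nullstellensatz.  On a monomial
    x^m the sum factors into one moment per variable.  Since m has at most the
    total degree of d, either m = d or m is smaller than d in some variable,
    whose moment is then 0. *)
Lemma grid_coef (d : 'X_{1..n}) (P : {mpoly K[n]}) :
  (msize P <= (mdeg d).+1)%N ->
  P@_d = \sum_(c : {ffun 'I_n -> 'I_(mdeg d).+1} | [forall i, (c i <= d i)%N])
    P.@[fun i => q ^+ c i] * \prod_i lagrange_weight (d i) (c i).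
Proof.
move=> sP; pose N := (mdeg d).+1.
under eq_bigr do rewrite mevalE big_distrl /=.
rewrite exchange_big /=.
have moment m : m \in msupp P ->
   \sum_(c : {ffun 'I_n -> 'I_N} | [forall i, (c i <= d i)%N])
     P@_m * (\prod_i (q ^+ c i) ^+ m i) * \prod_i lagrange_weight (d i) (c i)
   = P@_m * (m == d)%:R.
  move=> /msize_mdeg_lt mP.
  have {mP} md : (mdeg m <= mdeg d)%N by rewrite -ltnS (leq_trans mP).
  under eq_bigr do rewrite -mulrA -big_split /=.
  rewrite -big_distrr /=; congr (_ * _).
  rewrite (eq_bigl (mem (family (fun i => [pred v : 'I_N | (v <= d i)%N]))));
    last by move=> c; rewrite inE; apply/forallP/familyP.
  rewrite -(bigA_distr_big_dep _
    (fun i (v : 'I_N) => (q ^+ v) ^+ m i * lagrange_weight (d i) v)).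
  have widen i : \sum_(v : 'I_N | (v <= d i)%N)
       (q ^+ v) ^+ m i * lagrange_weight (d i) v
     = \sum_(v < (d i).+1) (q ^+ v) ^+ m i * lagrange_weight (d i) v.
    have dN : ((d i).+1 <= N)%N by rewrite ltnS mdegE (bigD1 i) //= leq_addr.
    by rewrite (big_ord_widen _
      (fun v => (q ^+ v) ^+ m i * lagrange_weight (d i) v) dN).
  under eq_bigr do rewrite widen.
  have [->|ne] := eqVneq.
    by rewrite big1 // => i _; rewrite lagrange_moment // eqxx.
  have [i mi] := mnm_lt_of_mdeg _ _ md ne.
  by rewrite (bigD1 i) //= lagrange_moment ?(ltnW mi) // ltn_eqF // mul0r.
rewrite (eq_big_seq _ moment).
have [dP|dP] := boolP (d \in msupp P).
  rewrite (bigD1_seq d) //= eqxx mulr1 big1 ?addr0 // => m /negPf ->.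
  by rewrite mulr0.
rewrite (memN_msupp_eq0 dP) big_seq big1 // => m mP.
by case: eqVneq dP => [<-|_ _]; rewrite ?mP // mulr0.
Qed.

Lemma grid_vanish (d : 'X_{1..n}) (P : {mpoly K[n]}) :
  (msize P <= (mdeg d).+1)%N ->
  (forall c : 'I_n -> nat, (forall i, c i <= d i)%N ->
     P.@[fun i => q ^+ c i] = 0) ->
  P@_d = 0.
Proof.
move=> sP P0; rewrite grid_coef // big1 // => c /forallP cd.
by rewrite (P0 (fun i => c i)) // mul0r.
Qed.

Lemma grid_single (d : 'X_{1..n}) (P : {mpoly K[n]}) (b : 'I_n -> nat) :
  (msize P <= (mdeg d).+1)%N -> (forall i, b i <= d i)%N ->
  (forall c : 'I_n -> nat, (forall i, c i <= d i)%N ->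
     P.@[fun i => q ^+ c i] != 0 -> c =1 b) ->
  P@_d = P.@[fun i => q ^+ b i] * \prod_i lagrange_weight (d i) (b i).
Proof.
move=> sP bd Pb; rewrite grid_coef //.
have bN i : (b i < (mdeg d).+1)%N.
  by rewrite ltnS (leq_trans (bd i)) // mdegE (bigD1 i) //= leq_addr.
rewrite (bigD1 [ffun i => Ordinal (bN i)]) /=; last first.
  by apply/forallP => i; rewrite ffunE; exact: bd.
rewrite [X in _ + X]big1 ?addr0 => [|c /andP[/forallP cd ne]].
  congr (_ * _); last by apply: eq_bigr => i _; rewrite ffunE.
  by apply: meval_eq => i; rewrite ffunE.
rewrite (_ : P.@[_] = 0) ?mul0r //; apply: contraNeq ne => /Pb eqb.
by apply/eqP/ffunP => i; apply/val_inj; rewrite ffunE; exact: eqb.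
Qed.

End Interpolation.

(** * Packings of intervals, and zeros of the Dyson polynomial *)

(** Intervals [al i, al i + a i) that are disjoint, with a gap wherever the
    order s is reversed, and that fit in a segment as long as all of them
    together, tile it in the order s.  The last interval l ends the segment, so
    the others satisfy the same hypotheses on a segment shorter by a l and are
    tiled by induction; if l were not s-maximal, the gap required before it
    would not fit. *)
Lemma packing {n} (s : 'S_n) (a al : 'I_n -> nat) (J : {set 'I_n}) :
  (forall i j, i \in J -> j \in J -> (s i < s j)%N ->
     (al i + a i <= al j) || (al j + a j < al i))%N ->
  (forall i, i \in J -> al i + a i <= \sum_(j in J) a j)%N ->
  forall i, i \in J -> al i = (\sum_(j in J | (s j < s i)%N) a j)%N.
Proof.
have [k] := ubnP #|J|; elim: k => // k IHk in J *; rewrite ltnS => Jk.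
move=> apart fit i0 i0J.
(* Empty intervals may share their starting point; key breaks ties by s. *)
pose key i := (al i * n + s i)%N.
have [l lJ lmax] : exists2 l, l \in J & forall i, i \in J -> (key i <= key l)%N.
  by case: (@arg_maxnP _ i0 (mem J) key i0J) => l lJ lmax; exists l.
have below i : i \in J -> i != l ->
    (al i + a i + (s l < s i) <= al l)%N.
  move=> iJ il; have := lmax i iJ; rewrite /key => keyle.
  have lt_s j : (s j < n)%N by [].
  have alle : (al i <= al l)%N by have := lt_s i; have := lt_s l; nia.
  have sne : (s i != s l :> nat) by rewrite val_eqE (inj_eq perm_inj).
  case: (ltngtP (s i) (s l)) sne => // slt _.
    by have := apart i l iJ lJ slt; lia.
  have allt : (al i < al l)%N by nia.
  by have := apart l i lJ iJ slt; lia.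
have sumJ : (\sum_(j in J) a j = a l + \sum_(j in J :\ l) a j)%N.
  by rewrite (big_setD1 l).
have fitl := fit l lJ; rewrite sumJ in fitl.
have IH : forall i, i \in J :\ l ->
    al i = (\sum_(j in J :\ l | (s j < s i)%N) a j)%N.
  apply: IHk => [|i j|i].
  - by rewrite (cardsD1 l) lJ in Jk.
  - by move=> /setD1P[_ iJ] /setD1P[_ jJ]; apply: apart.
  - by move=> /setD1P[il iJ]; have := below i iJ il; lia.
have top m : m \in J :\ l ->
    (al l <= \sum_(j in J :\ l) a j <= al l)%N /\
    (forall i, i \in J :\ l -> s i < s l)%N.
  move=> mJ.
  case: (@arg_maxnP _ m (mem (J :\ l)) (fun i => s i : nat) mJ) => p pJ pmax.
  have alp : (al p + a p = \sum_(j in J :\ l) a j)%N.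
    rewrite (IH p pJ) [RHS](bigD1 p) //= addnC; congr addn.
    apply: eq_bigl => j; case jJ: (j \in J :\ l) => //=.
    have jp : (s j <= s p)%N := pmax j jJ.
    by rewrite ltn_neqAle jp andbT val_eqE (inj_eq perm_inj).
  have [pl pJ'] := setD1P pJ; have := below p pJ' pl.
  split; first by lia.
  move=> i iJ; apply: leq_ltn_trans (pmax i iJ) _.
  have sne : (s p != s l :> nat) by rewrite val_eqE (inj_eq perm_inj).
  by lia.
have [->|il] := eqVneq i0 l.
  rewrite (eq_bigl (fun j => j \in J :\ l)); last first.
    move=> j; rewrite !inE; case: eqVneq => [->|jl] /=; first by rewrite ltnn andbF.
    case jJ: (j \in J) => //=; have jJl : j \in J :\ l by rewrite !inE jl.
    by have [_ ->] := top j jJl.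
  have [J0|[m mJ]] := set_0Vmem (J :\ l); last first.
    by have [] := top m mJ; lia.
  by move: fitl; rewrite J0 big_set0; lia.
have i0J' : i0 \in J :\ l by rewrite !inE il.
rewrite (IH i0 i0J'); apply: eq_bigl => j; rewrite !inE.
case: eqVneq => [->|jl] //=; rewrite lJ /=.
by have [_ /(_ i0 i0J') /ltnW] := top i0 i0J'; rewrite leqNgt => /negPf ->.
Qed.

Section DysonPolynomial.
Context {K : fieldType} (q : K) {n : nat}.

(** The order of the variables in the product is a permutation s of the indices,
    so that exchanging two of them is a change of s. *)
Definition dyson_poly (s : 'S_n) (a : 'I_n -> nat) : {mpoly K[n]} :=
  \prod_i \prod_(j | j != i) \prod_(u < a i)
    ('X_j - q ^+ (u + (s j < s i)%N) *: 'X_i).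

Definition dyson_mnm (a : 'I_n -> nat) : 'X_{1..n} :=
  [multinom (\sum_j a j - a i)%N | i < n].

Lemma msizeM_leq (l : nat) (p r : {mpoly K[n]}) :
  (msize r <= l.+1)%N -> (msize (p * r) <= msize p + l)%N.
Proof.
have [->|p0] := eqVneq p 0; first by rewrite mul0r msize0.
have [->|r0] := eqVneq r 0; first by rewrite mulr0 msize0.
rewrite msizeM // => rl.
by rewrite -subn1 leq_subLR add1n -addnS leq_add2l.
Qed.

Lemma msize_prod (I : Type) (r : seq I) (P : pred I)
    (G : I -> {mpoly K[n]}) (e : I -> nat) :
  (forall i, P i -> msize (G i) <= (e i).+1)%N ->
  (msize (\prod_(i <- r | P i) G i) <= (\sum_(i <- r | P i) e i).+1)%N.
Proof.
move=> sG; apply: (big_ind2 (fun p k => msize p <= k.+1)%N) => //.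
- by rewrite msize1.
- move=> p k p' k' pk /msizeM_leq pk'.
  by apply: leq_trans (pk' p) _; rewrite -addSn leq_add2r.
Qed.

Lemma mdeg_dyson_mnm a : (mdeg (dyson_mnm a) + \sum_i a i = n * \sum_i a i)%N.
Proof.
rewrite mdegE -big_split /= (eq_bigr (fun=> \sum_i a i)%N) => [|i _].
  by rewrite sum_nat_const card_ord.
by rewrite mnmE subnK // (bigD1 i) //= leq_addr.
Qed.

Lemma msize_linear_le (i j : 'I_n) (c : K) :
  (msize ('X_j - c *: 'X_i : {mpoly K[n]}) <= 2)%N.
Proof.
apply: leq_trans (msizeD_le _ _) _; rewrite geq_max msizeN msizeX mdeg1 /=.
by apply: leq_trans (msizeZ_le _ _) _; rewrite msizeX mdeg1.
Qed.

Lemma msize_dyson_poly s a :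
  (msize (dyson_poly s a) <= (mdeg (dyson_mnm a)).+1)%N.
Proof.
have sz : (msize (dyson_poly s a) <=
    (\sum_i \sum_(j | j != i) \sum_(u < a i) 1).+1)%N.
  do 3!(apply: msize_prod => ? _); exact: msize_linear_le.
apply: leq_trans sz _; rewrite ltnS.
under eq_bigr => i _ do
  (under eq_bigr do rewrite sum_nat_const card_ord muln1;
   rewrite sum_nat_const cardC1 card_ord).
by rewrite -big_distrr /= -subn1 mulnBl mul1n -mdeg_dyson_mnm addnK.
Qed.

(** A factor vanishes at q^al as soon as al j lies in the range of length a i
    starting at al i, or at al i + 1 when j comes before i. *)
Lemma dyson_poly_neq0 s a (al : 'I_n -> nat) :
  (dyson_poly s a).@[fun i => q ^+ al i] != 0 ->
  forall i j, (s i < s j)%N ->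
    ((al i + a i <= al j) || (al j + a j < al i))%N.
Proof.
move=> nz i j sij.
have factor x y u : x != y -> (u < a x)%N ->
    al y != (u + (s y < s x) + al x)%N.
  move=> xy ux; apply: contraNneq nz => e.
  rewrite /dyson_poly (bigD1 x) //= (bigD1 y) 1?eq_sym //=.
  rewrite (bigD1 (Ordinal ux)) //= !mevalM mevalB mevalZ !mevalXU.
  by rewrite e exprD subrr !mul0r.
have ne : i != j by apply: contraTneq sij => ->; rewrite ltnn.
have sji : (s j < s i)%N = false by apply/negbTE; rewrite -leqNgt ltnW.
have := factor i j (al j - al i)%N ne; rewrite sji.
have := factor j i (al i - al j).-1%N; rewrite eq_sym sij => /(_ ne).
lia.
Qed.

End DysonPolynomial.

(** * The q-Dyson theorem *)

Definition partial_sum {n} (a : 'I_n -> nat) (k : nat) : nat :=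
  \sum_(j < n | (j < k)%N) a j.

Section PartialSums.
Context {n : nat} (a : 'I_n -> nat).

Lemma partial_sumS (i : 'I_n) :
  partial_sum a i.+1 = (partial_sum a i + a i)%N.
Proof.
rewrite /partial_sum (bigD1 i) //= addnC; congr addn.
by apply: eq_bigl => j; rewrite ltnS ltn_neqAle andbC -val_eqE.
Qed.

Lemma partial_sum_leq k l : (k <= l)%N -> (partial_sum a k <= partial_sum a l)%N.
Proof.
move=> kl; rewrite /partial_sum [X in (_ <= X)%N](bigID (fun j : 'I_n => j < k)%N) /=.
rewrite (eq_bigl (fun j : 'I_n => (j < l) && (j < k))%N) ?leq_addr // => j.
by lia.
Qed.

Lemma partial_sum_all : partial_sum a n = \sum_j a j.
Proof. by apply: eq_bigl => j; rewrite ltn_ord. Qed.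

(** The consecutive intervals [partial_sum a j, partial_sum a j + a j) tile the
    range between two partial sums. *)
Lemma prod_tile (R : comNzRingType) (g : nat -> R) (k l : nat) :
  (k <= l <= n)%N ->
  \prod_(j < n | (k <= j < l)%N) \prod_(u < a j) g (partial_sum a j + u)%N
  = \prod_(partial_sum a k <= v < partial_sum a l) g v.
Proof.
elim: l => [|l IHl] /andP[kl ln].
  move: kl; rewrite leqn0 => /eqP ->.
  by rewrite big_geq // big_pred0.
move: kl; rewrite leq_eqVlt => /predU1P[->|kl].
  by rewrite big_geq ?big_pred0 // => j; lia.
rewrite (bigD1 (Ordinal ln)) /=; last by lia.
rewrite (eq_bigl (fun j : 'I_n => (k <= j < l)%N)) => [|j]; last first.
  by rewrite -val_eqE /=; lia.
rewrite IHl; last by lia.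
rewrite (partial_sumS (Ordinal ln)) /=.
rewrite [RHS](big_cat_nat _ (n := partial_sum a l)) ?partial_sum_leq ?leq_addr //=.
rewrite mulrC; congr (_ * _).
rewrite -{2}[partial_sum a l]add0n big_addn addKn big_mkord.
by apply: eq_bigr => u _; rewrite addnC.
Qed.

End PartialSums.

Section QDyson.
Context {K : fieldType} (q : K).
Hypothesis q_inj : injective (fun k : nat => q ^+ k).

Lemma q_neq0 : q != 0.
Proof.
by apply/eqP => q0; have := @q_inj 1 2; rewrite q0 !expr0n => /(_ erefl).
Qed.

Lemma qpow_neq0 k : q ^+ k != 0. Proof. by rewrite expf_neq0 // q_neq0. Qed.

Lemma qpow_eq k l : (q ^+ k == q ^+ l) = (k == l).
Proof. exact: (inj_eq q_inj). Qed.

Lemma qpoch_neq0 k : qpoch q q k != 0.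
Proof.
apply/prodf_neq0 => i _; rewrite -exprS subr_eq0 eq_sym.
by rewrite -[1](expr0 q) qpow_eq.
Qed.

Lemma prod_qpow_diff (b m e : nat) :
  \prod_(b + m <= v < b + (m + e)) (q ^+ b - q ^+ v.+1)
  = q ^+ (b * e) * (qpoch q q (m + e) / qpoch q q m).
Proof.
have -> : qpoch q q (m + e) / qpoch q q m = \prod_(v < e) (1 - q * q ^+ (m + v)).
  by rewrite /qpoch big_split_ord /= mulrAC divff ?mul1r // qpoch_neq0.
rewrite addnA -{1}[(b + m)%N]add0n big_addn addKn big_mkord.
have -> : q ^+ (b * e) = \prod_(v < e) q ^+ b.
  by rewrite prodr_const card_ord exprM.
rewrite -big_split /=; apply: eq_bigr => v _.
by rewrite mulrBr mulr1 -exprS -exprD; congr (_ - _ ^+ _); lia.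
Qed.

Context {n : nat}.

Lemma prod_around (g : nat -> K) (b d : nat) : (b <= d)%N ->
  \prod_(u < d.+1 | u != b :> nat) g u =
  \prod_(0 <= v < b) g v * \prod_(b <= v < d) g v.+1.
Proof.
move=> bd; rewrite -(big_mkord (fun u => u != b)) (big_cat_nat _ (n := b)) ?leqW //=.
congr (_ * _).
  by rewrite big_nat_cond [RHS]big_nat_cond; apply: eq_bigl => v; lia.
rewrite big_ltn_cond ?ltnS // eqxx /= big_add1 /=.
by rewrite big_nat_cond [RHS]big_nat_cond; apply: eq_bigl => v; lia.
Qed.

(** By [packing] a single grid point contributes, the exponents there being the
    partial sums of a.  The factors of F at this point, collected according to
    the variable x_i that is not multiplied by a power of q, run over two ranges
    of exponents.  The lower range cancels against the Lagrange weight, the upper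
    one leaves a q-binomial coefficient, and these telescope. *)
Lemma qDyson_coef (a : 'I_n.+1 -> nat) :
  (dyson_poly q 1 a)@_(dyson_mnm a) =
  qpoch q q (\sum_i a i) / \prod_i qpoch q q (a i).
Proof.
pose S := (\sum_i a i)%N; pose b (i : 'I_n.+1) := partial_sum a i.
have b_leq k : (k <= n.+1)%N -> (partial_sum a k <= S)%N.
  by move=> kn; rewrite /S -partial_sum_all partial_sum_leq.
have bS i : (b i + a i <= S)%N by rewrite -partial_sumS b_leq.
have b_apart c : (dyson_poly q 1 a).@[fun i => q ^+ c i] != 0 ->
    (forall i, c i <= dyson_mnm a i)%N -> c =1 b.
  move=> nz cd i.
  rewrite (@packing _ 1 a c setT) ?inE //.
  - by apply: eq_bigl => j; rewrite inE !perm1.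
  - by move=> j k _ _; apply: dyson_poly_neq0 nz _ _.
  - move=> j _; rewrite (eq_bigl xpredT) => [|k]; last by rewrite inE.
    have := cd j; rewrite mnmE -/S => cj; have := bS j => bj.
    by rewrite -/S -leq_subRL; lia.
rewrite (grid_single q q_inj _ _ b) ?msize_dyson_poly //; first last.
- by move=> c cd nz; apply: b_apart.
- by move=> i; rewrite mnmE; have := bS i; rewrite /S; lia.
have local (i : 'I_n.+1) :
    (\prod_(j | j != i) \prod_(u < a j)
       (q ^+ b i - q ^+ (u + (i < j)%N) * q ^+ b j))
      * lagrange_weight q (S - a i) (b i)
   = qpoch q q (S - b i) / qpoch q q (S - partial_sum a i.+1) / qpoch q q (a i).
  pose g v := q ^+ b i - q ^+ v.
  have -> : \prod_(j | j != i) \prod_(u < a j)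
       (q ^+ b i - q ^+ (u + (i < j)%N) * q ^+ b j)
     = \prod_(0 <= v < b i) g v * \prod_(partial_sum a i.+1 <= v < S) g v.+1.
    rewrite (bigID (fun j : 'I_n.+1 => j < i)%N) /=; congr (_ * _).
      have -> : 0%N = partial_sum a 0 by rewrite /partial_sum big_pred0.
      rewrite -(prod_tile a); last by have := ltn_ord i; lia.
      apply: eq_big => [j|j /andP[_ ji]].
        by rewrite -val_eqE /=; lia.
      apply: eq_bigr => u _; rewrite /g [(i < j)%N]ltnNge (ltnW ji) addn0.
      by rewrite -exprD addnC.
    rewrite /S -partial_sum_all -(prod_tile a _ (fun v => g v.+1)); last first.
      by rewrite ltn_ord leqnn.
    apply: eq_big => [j|j /andP[ne ji]].
      by rewrite ltn_ord andbT -val_eqE /=; lia.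
    have {}ji : (i < j)%N by rewrite ltn_neqAle leqNgt ji eq_sym val_eqE ne.
    by apply: eq_bigr => u _; rewrite /g ji -exprD addn1 addSn addnC.
  have bSi := bS i; pose e := (S - (b i + a i))%N.
  rewrite /lagrange_weight (prod_around g); last by lia.
  rewrite partial_sumS -/(b i).
  have -> : \prod_(b i + a i <= v < S) g v.+1
      = q ^+ (b i * e) * (qpoch q q (S - b i) / qpoch q q (a i)).
    have := prod_qpow_diff (b i) (a i) e.
    by rewrite (_ : a i + e = S - b i)%N ?subnKC //; rewrite /e; lia.
  have -> : \prod_(b i <= v < S - a i) g v.+1
      = q ^+ (b i * e) * qpoch q q (S - (b i + a i)).
    have := prod_qpow_diff (b i) 0 e; rewrite addn0 add0n.
    rewrite (_ : b i + e = S - a i)%N; last by rewrite /e; lia.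
    by rewrite {2}/qpoch big_ord0 divr1.
  have g0 : \prod_(0 <= v < b i) g v != 0.
    rewrite big_mkord; apply/prodf_neq0 => v _.
    by rewrite subr_eq0 qpow_eq gtn_eqF.
  have := qpoch_neq0 (a i); have := qpoch_neq0 (S - (b i + a i)).
  have := qpow_neq0 (b i * e); move: g0.
  by move=> *; field; do ?[apply/andP; split].
have -> : (dyson_poly q 1 a).@[fun i => q ^+ b i]
    = \prod_i \prod_(j | j != i) \prod_(u < a j)
        (q ^+ b i - q ^+ (u + (i < j)%N) * q ^+ b j).
  rewrite /dyson_poly rmorph_prod /=.
  under eq_bigr => i _ do
    (rewrite rmorph_prod /=; under eq_bigr => j _ do
      (rewrite rmorph_prod /=; under eq_bigr => u _ do
         rewrite mevalB mevalZ !mevalXU !perm1)).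
  rewrite (exchange_big_dep xpredT) //=.
  by apply: eq_bigr => i _; apply: eq_bigl => j; rewrite eq_sym.
rewrite -big_split /=; under eq_bigr => i _ do rewrite mnmE local.
rewrite prodf_div; congr (_ / _); rewrite /b.
rewrite -(big_mkord xpredT (fun k =>
  qpoch q q (S - partial_sum a k) / qpoch q q (S - partial_sum a k.+1))).
rewrite (telescope_prodr_eq (fun k => qpoch q q (S - partial_sum a k))) //.
- rewrite partial_sum_all subnn {2}/qpoch big_ord0 divr1.
  by rewrite (_ : partial_sum a 0 = 0%N) ?subn0 // /partial_sum big_pred0.
- by move=> k _; rewrite unitfE qpoch_neq0.
Qed.

End QDyson.

(** * Exchanging neighbouring variables *)

(** When the bounds exceed the total length by one and the interval l uses this
    extra unit, it lies after every other interval, and removing it leaves a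
    packing problem on the remaining indices.  The bound for i keeps an extra
    unit only if i precedes l in the order. *)
Lemma packing_peel {n} (s : 'S_n) (a al : 'I_n -> nat) (J : {set 'I_n}) l i :
  (forall i j, i \in J -> j \in J -> (s i < s j)%N ->
     (al i + a i <= al j) || (al j + a j < al i))%N ->
  l \in J -> al l + a l = (\sum_(j in J) a j).+1 ->
  i \in J -> i != l -> (al i + a i <= \sum_(j in J) a j + (s i < s l))%N ->
  (al i + a i <= \sum_(j in J :\ l) a j + (s i < s l))%N.
Proof.
move=> apart lJ; rewrite (big_setD1 l lJ) /= => top iJ il.
have sne : (s i != s l :> nat) by rewrite val_eqE (inj_eq perm_inj).
case: (ltngtP (s i) (s l)) sne => // slt _.
  by have := apart i l iJ lJ slt; lia.
by have := apart l i lJ iJ slt; lia.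
Qed.

Section Relations.
Context {K : fieldType} (q : K).
Hypothesis q_inj : injective (fun k : nat => q ^+ k).
Context {n : nat}.
Implicit Types (a : 'I_n.+1 -> nat) (d : 'X_{1..n.+1}).

(** G' agrees with G in top degree, and below this degree nothing contributes to
    the coefficient of x^d; so the vanishing on the grid may be arranged with the
    lower terms of G', which need not be homogeneous. *)
Lemma top_form_coef (e : nat) d (H G G' : {mpoly K[n.+1]}) :
  (msize H + e <= mdeg d)%N -> (msize G <= e.+2)%N -> (msize (G' - G) <= e.+1)%N ->
  (forall c : 'I_n.+1 -> nat, (forall i, c i <= d i)%N ->
     (H * G').@[fun i => q ^+ c i] = 0) ->
  (H * G)@_d = 0.
Proof.
move=> sH sG sG' vanish.
have lower : (H * (G' - G))@_d = 0.
  apply/memN_msupp_eq0/msize_mdeg_ge.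
  by apply: leq_trans (msizeM_leq e _ _ sG') _.
have -> : H * G = H * G' - H * (G' - G) by ring.
rewrite mcoeffB lower subr0; apply: (grid_vanish q q_inj) => //.
have {sG}sG' : (msize G' <= e.+2)%N.
  have -> : G' = G + (G' - G) by ring.
  by apply: leq_trans (msizeD_le _ _) _; rewrite geq_max sG ltnW.
by apply: leq_trans (msizeM_leq e.+1 _ _ sG') _; rewrite addnS.
Qed.

Lemma msymXU (s : 'S_n.+1) i : msym s 'X_i = 'X_(s i) :> {mpoly K[n.+1]}.
Proof.
rewrite msymX; congr mpolyX; apply/mnmP => j.
by rewrite mnmE !mnm1E -(inj_eq (@perm_inj _ s)) permKV.
Qed.

Lemma msym_dyson_poly (s : 'S_n.+1) a :
  msym s (dyson_poly q 1 (a \o s)) = dyson_poly q s^-1 a.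
Proof.
rewrite /dyson_poly rmorph_prod /= [RHS](reindex_perm s) /=.
apply: eq_bigr => i _; rewrite rmorph_prod /= [RHS](reindex_perm s) /=.
apply: eq_big => [j|j _]; first by rewrite (inj_eq perm_inj).
rewrite rmorph_prod /=; apply: eq_bigr => u _.
by rewrite msymB msymZ !msymXU !perm1 !permK.
Qed.

Definition eq_mod_var (t : 'I_n.+1) (x y : {mpoly K[n.+1]}) := exists w, x - y = 'X_t * w.

Lemma eq_mod_varM t x y x' y' : eq_mod_var t x y -> eq_mod_var t x' y' -> eq_mod_var t (x * x') (y * y').
Proof.
move=> [w e] [w' e']; exists (w * x' + y * w').
by rewrite mulrDr mulrA -e mulrCA -e'; ring.
Qed.

Lemma eq_mod_var_prod t m (F G : 'I_m -> {mpoly K[n.+1]}) :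
  (forall u, eq_mod_var t (F u) (G u)) -> eq_mod_var t (\prod_u F u) (\prod_u G u).
Proof.
move=> FG; apply: (big_ind2 (eq_mod_var t)) => // [|x y x' y']; last exact: eq_mod_varM.
by exists 0; rewrite subrr mulr0.
Qed.

(** Only the factors involving both k and t differ between the two orders.
    Modulo x_t they reduce to products of multiples of x_k, whose coefficients
    q^u in one order and q^(u + 1) in the other account for q^a_k. *)
Lemma dyson_swap a (k t : 'I_n.+1) : t = k.+1 :> nat ->
  exists W, q ^+ a k *: dyson_poly q 1 a - dyson_poly q (tperm k t) a = 'X_t * W.
Proof.
move=> tk; have kt' : (k < t)%N by rewrite tk.
have tk' : (t < k)%N = false by rewrite tk ltnNge leqnSn.
have ktne : k != t by rewrite -val_eqE /= tk ltn_eqF.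
pose f (s : 'S_n.+1) (p : 'I_n.+1 * 'I_n.+1) : {mpoly K[n.+1]} :=
  \prod_(u < a p.1) ('X_p.2 - q ^+ (u + (s p.2 < s p.1)%N) *: 'X_p.1).
pose R := \prod_(p | (p.2 != p.1) && (p != (k, t)) && (p != (t, k))) f 1%g p.
have split s : s = 1%g \/ s = tperm k t ->
    dyson_poly q s a = f s (k, t) * f s (t, k) * R.
  move=> s_or; rewrite /dyson_poly pair_big_dep /= (bigD1 (k, t)) 1?eq_sym //=.
  rewrite (bigD1 (t, k)) /=; last by rewrite ktne xpair_eqE eq_sym (negPf ktne).
  rewrite mulrA; congr (_ * _); apply: eq_bigr => -[i j] /=.
  rewrite !xpair_eqE => ne; apply: eq_bigr => u _; 
  congr (_ - _ ^+ (_ + nat_of_bool _) *: _).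
  rewrite !perm1; case: s_or => ->; first by rewrite !perm1.
  move: ne; rewrite -!val_eqE /=.
  case: tpermP => [->|->|/eqP + /eqP +]; case: tpermP => [->|->|/eqP + /eqP +];
    rewrite -?val_eqE /= ?tk; lia.
have [W eqW] : eq_mod_var t ((q ^+ a k)%:MP * (f 1%g (k, t) * f 1%g (t, k)))
                    (f (tperm k t) (k, t) * f (tperm k t) (t, k)).
  have -> : (q ^+ a k)%:MP * (f 1%g (k, t) * f 1%g (t, k))
      = (\prod_(u < a k) (q%:MP * ('X_t - q ^+ u *: 'X_k))) * f 1%g (t, k).
    rewrite mulrA big_split /= prodr_const card_ord -rmorphXn /=.
    congr (_ * _ * _); apply: eq_bigr => u _.
    by rewrite /= !perm1 tk' addn0.
  apply: eq_mod_varM; apply: eq_mod_var_prod => u /=; rewrite ?perm1 tpermL tpermR kt' ?tk'.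
    exists ((q - 1)%:MP); rewrite addn1 exprS.
    by rewrite -!mul_mpolyC mpolyCM mpolyCB; ring.
  exists ((q ^+ (u + false) - q ^+ (u + true))%:MP).
  by rewrite -!mul_mpolyC mpolyCB; ring.
exists (W * R); rewrite !split ; [|by right|by left].
by rewrite -mul_mpolyC mulrA -mulrBl eqW mulrA.
Qed.

(** The constant term of x_r^2 / (x_0 x_t) times the q-Dyson product, see
    [CT_second_layer]. *)
Definition second_layer a (r t : 'I_n.+1) : K :=
  ('X_r ^+ 2 * dyson_poly q 1 a)@_(dyson_mnm a + U_(ord0) + U_(t))%MM.

Lemma msize_add_le e (p r : {mpoly K[n.+1]}) :
  (msize p <= e)%N -> (msize r <= e)%N -> (msize (p + r) <= e)%N.
Proof. by move=> pe re; apply: leq_trans (msizeD_le _ _) _; rewrite geq_max pe. Qed.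

Lemma msize_monomial_le e (c : K) (m : 'X_{1..n.+1}) :
  (mdeg m < e)%N -> (msize (c *: 'X_[m]) <= e)%N.
Proof. by move=> me; apply: leq_trans (msizeZ_le _ _) _; rewrite msizeX. Qed.

Lemma dyson_apart s a (c : 'I_n.+1 -> nat) :
  (dyson_poly q s a).@[fun i => q ^+ c i] != 0 ->
  forall J : {set 'I_n.+1}, forall i j, i \in J -> j \in J -> (s i < s j)%N ->
    ((c i + a i <= c j) || (c j + a j < c i))%N.
Proof. by move=> nz J i j _ _; apply: dyson_poly_neq0 nz i j. Qed.

(** With one extra unit for the first index only, either it is not used and the
    intervals tile the segment in the order s, or 0 moves to the end and the other indices tile
    the segment without it. *)
Lemma first_layer_points (s : 'S_n.+1) a (c : 'I_n.+1 -> nat) :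
  s ord0 = ord0 ->
  (dyson_poly q s a).@[fun i => q ^+ c i] != 0 ->
  (forall i, c i <= (dyson_mnm a + U_(ord0))%MM i)%N ->
  (c =1 fun i => \sum_(j | (s j < s i)%N) a j)%N \/
  (forall i, i != ord0 -> c i = \sum_(j | (j != ord0) && (s j < s i)%N) a j)%N.
Proof.
move=> s0 /dyson_apart apart cd; pose S := (\sum_j a j)%N.
have sumT : (\sum_(j in [set: 'I_n.+1]) a j)%N = S.
  by apply: eq_bigl => j; rewrite inE.
have aS i : (a i <= S)%N by rewrite /S (bigD1 i) //= leq_addr.
have cS i : (c i + a i <= S + (i == ord0))%N.
  by have := cd i; have := aS i; rewrite mnmDE mnmE mnm1E eq_sym -/S; lia.
have [c0|c0] := leqP (c ord0 + a ord0) S.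
  left=> i; rewrite (@packing _ s a c setT) ?inE //.
  - by apply: eq_bigl => j; rewrite inE.
  - exact: apart.
  - move=> j _; rewrite sumT; have [->//|j0] := eqVneq j ord0.
    by have := cS j; rewrite (negPf j0) addn0.
right=> i i0; rewrite (@packing _ s a c (setT :\ ord0)) ?inE ?i0 //.
- by apply: eq_bigl => j; rewrite !inE andbT.
- exact: apart.
move=> j; rewrite !inE andbT => j0.
have := @packing_peel _ s a c setT ord0 j (apart _) (in_setT _).
rewrite sumT s0 ltn0 !addn0; apply; rewrite ?inE //.
  by have := cS ord0; rewrite eqxx; lia.
by have := cS j; rewrite (negPf j0) addn0.
Qed.

(** The quotient W of q^a_k F - F' by x_t is nonzero at q^c only if F or F' is,
    and the two orders agree on which indices precede r; hence c_r takes one of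
    two values on the grid, and the product of the two corresponding factors
    replaces x_r^2. *)
Lemma second_layer_swap a (r k t : 'I_n.+1) :
  (0 < k)%N -> t = k.+1 :> nat -> (t < r)%N ->
  q ^+ a k * second_layer a r t = second_layer (a \o tperm k t) r k.
Proof.
move=> k0 tk tr; pose s := tperm k t; pose m := (dyson_mnm a + U_(ord0) + U_(t))%MM.
have sr : s r = r by rewrite tpermD // -val_eqE /= ltn_eqF //; lia.
have s0 : s ord0 = ord0 by rewrite tpermD // -val_eqE /=; lia.
have -> : second_layer (a \o s) r k = ('X_r ^+ 2 * dyson_poly q s a)@_m.
  rewrite -[s in dyson_poly q s a]tpermV -/s -msym_dyson_poly.
  have -> : 'X_r ^+ 2 = msym s ('X_r ^+ 2) :> {mpoly K[n.+1]}.
    by rewrite rmorphXn /= msymXU sr.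
  rewrite -msymM mcoeff_sym; congr mcoeff; apply/mnmP => i.
  have sum_s : (\sum_j (a \o s) j = \sum_j a j)%N by rewrite [RHS](reindex_perm s).
  rewrite !mnmE sum_s; congr (_ + _ + _)%N.
    by rewrite -(inj_eq (@perm_inj _ s)) s0.
  by rewrite -(inj_eq (@perm_inj _ s)) tpermL.
apply/eqP; rewrite -subr_eq0 -mcoeffZ -mcoeffB scalerAr -mulrBr.
have [W eqW] := dyson_swap a k t tk; rewrite eqW.
rewrite [_ * W]mulrC mulrA /m addmC mcoeffMX mulrC.
(* By first_layer_points, c1 and c2 are the only values of x_r on the grid
   where W does not vanish. *)
pose c1 := q ^+ (\sum_(j < n.+1 | (j < r)%N) a j)%N.
pose c2 := q ^+ (\sum_(j | (j != ord0) && (j < r)%N) a j)%N.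
have sW : (msize W <= mdeg (dyson_mnm a))%N.
  have [->|W0] := eqVneq W 0; first by rewrite msize0.
  have Xt0 : 'X_t != 0 :> {mpoly K[n.+1]} by rewrite -msize_poly_eq0 msizeX.
  rewrite -ltnS -[(msize W).+1]/(2 + msize W).-1 -(mdeg1 t) -(msizeX K) -msizeM //.
  rewrite -eqW (leq_trans (msizeD_le _ _)) // msizeN geq_max msize_dyson_poly andbT.
  by apply: leq_trans (msizeZ_le _ _) (msize_dyson_poly _ _ _).
apply/eqP; apply: (top_form_coef 1 (dyson_mnm a + U_(ord0))%MM W ('X_r ^+ 2)
  (('X_r - c1%:MP) * ('X_r - c2%:MP))).
- by rewrite mdegD mdeg1 leq_add2r.
- by rewrite mpolyXn msizeX mdegMn mdeg1.
- have -> : ('X_r - c1%:MP) * ('X_r - c2%:MP) - 'X_r ^+ 2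
      = - (c1 + c2) *: 'X_r + (c1 * c2) *: 'X_[0] :> {mpoly K[n.+1]}.
    by rewrite mpolyX0 -!mul_mpolyC mpolyCN mpolyCD mpolyCM; ring.
  by apply: msize_add_le; apply: msize_monomial_le; rewrite ?mdeg1 ?mdeg0.
move=> c cd; apply/eqP; rewrite !mevalM !mevalB !mevalC mevalXU.
rewrite mulf_eq0; have [//|/= W0] := eqVneq W.@[_] 0.
rewrite mulf_eq0 !subr_eq0.
have {W0} : (q ^+ a k *: dyson_poly q 1 a - dyson_poly q s a).@[fun i => q ^+ c i] != 0.
  by rewrite eqW mevalM mevalXU mulf_neq0 // qpow_neq0.
rewrite mevalB mevalZ => nz.
have [s' s'_or {}nz] : exists2 s' : 'S_n.+1, s' = 1%g \/ s' = s
    & (dyson_poly q s' a).@[fun i => q ^+ c i] != 0.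
  have [z|nz1] := eqVneq (dyson_poly q 1 a).@[fun i => q ^+ c i] 0.
    by exists s; [right|move: nz; rewrite z mulr0 sub0r oppr_eq0].
  by exists 1%g; [left|].
have below (j : 'I_n.+1) : (s' j < s' r)%N = (j < r)%N.
  case: s'_or => ->; first by rewrite !perm1.
  by rewrite sr; case: tpermP => // ->; lia.
have s'0 : s' ord0 = ord0 by case: s'_or => ->; rewrite ?perm1.
have r0 : r != ord0 by rewrite -val_eqE /=; lia.
have [->|/(_ r r0) ->] := first_layer_points s' a c s'0 nz cd.
  by rewrite (eq_bigl _ _ below) eqxx.
rewrite (eq_bigl (fun j => (j != ord0) && (j < r)%N)) ?eqxx ?orbT // => j.
by rewrite below.
Qed.
End Relations.

(** * The case where x_t follows x_0 *)

Lemma sum_split01 {n} (a : 'I_n.+1 -> nat) (t : 'I_n.+1) (P : pred 'I_n.+1) :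
  t = 1%N :> nat ->
  (\sum_(j | P j) a j =
   P ord0 * a ord0 + (P t * a t + \sum_(j : 'I_n.+1 | P j && (1 < j)%N) a j))%N.
Proof.
move=> t1; rewrite big_mkcond (bigD1 ord0) //= (bigD1 t) /=; last first.
  by rewrite -val_eqE /= t1.
rewrite -!mulnbl; congr (_ + (_ + _))%N; rewrite [LHS]big_mkcond [RHS]big_mkcond /=.
by apply: eq_bigr => j _; rewrite -!val_eqE /= t1; case: (P j); case: (j : nat) => [|[|]].
Qed.

Section Base.
Context {K : fieldType} (q : K).
Hypothesis q_inj : injective (fun k : nat => q ^+ k).
Context {n : nat} (a : 'I_n.+1 -> nat) (r t : 'I_n.+1).
Hypotheses (t1 : t = 1%N :> nat) (tr : (t < r)%N).

Local Notation B := (\sum_(j < n.+1 | (1 < j)%N) a j)%N.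
Local Notation Y := (\sum_(j < n.+1 | (1 < j < r)%N) a j)%N.

(** The indices 0 and t may each use the extra unit, which makes four cases.  If t
    uses it, t comes last ([packing_peel]); the remaining bound of 0 still
    exceeds their total length by one since 0 precedes t.  If 0 uses it as well,
    it is last among the remaining ones. *)
Lemma second_layer_points (c : 'I_n.+1 -> nat) :
  (dyson_poly q 1 a).@[fun i => q ^+ c i] != 0 ->
  (forall i, c i <= (dyson_mnm a + U_(ord0) + U_(t))%MM i)%N ->
  (c ord0, c t, c r) \in
   [:: (0, a ord0, a ord0 + a t + Y);
       ((a t + B).+1, 0, a t + Y);
       (0, (a ord0 + B).+1, a ord0 + Y);
       (B.+1, (a ord0 + B).+1, Y)]%N.
Proof.
move=> /dyson_apart apart cd.
have t0 : t != ord0 by rewrite -val_eqE /= t1.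
have r0 : r != ord0 by rewrite -val_eqE /=; lia.
have rt : r != t by rewrite -val_eqE /=; lia.
have sumT : (\sum_(j in [set: 'I_n.+1]) a j = a ord0 + (a t + B))%N.
  by rewrite (sum_split01 _ t) // !inE !mul1n; do 2!congr addn; apply: eq_bigl => j; rewrite inE.
have sumNt : (\sum_(j in [set: 'I_n.+1] :\ t) a j = a ord0 + B)%N.
  by apply: (@addnI (a t)); rewrite -big_setD1 ?inE // sumT addnCA.
have sumN0 : (\sum_(j in [set: 'I_n.+1] :\ ord0) a j = a t + B)%N.
  by apply: (@addnI (a ord0)); rewrite -big_setD1 ?inE // sumT.
have sumN0t : (\sum_(j in [set: 'I_n.+1] :\ t :\ ord0) a j = B)%N.
  by apply: (@addnI (a ord0)); rewrite -big_setD1 ?inE 1?eq_sym ?t0 // sumNt.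
have aS i : (a i <= a ord0 + (a t + B))%N.
  by rewrite -sumT (big_setD1 i) ?inE ?leq_addr.
have cS i : (c i + a i <= a ord0 + (a t + B) + (i == ord0) + (i == t))%N.
  have := cd i; have := aS i; rewrite !mnmDE mnmE !mnm1E !(eq_sym i).
  have -> : (\sum_j a j = a ord0 + (a t + B))%N.
    by rewrite -sumT; apply: eq_bigl => j; rewrite inE.
  by lia.
have values (J : {set 'I_n.+1}) :
    (forall j : 'I_n.+1, (1 < j)%N -> j \in J) ->
    (forall i, i \in J -> c i + a i <= \sum_(j in J) a j)%N ->
    [/\ ord0 \in J -> c ord0 = 0%N, t \in J -> c t = (ord0 \in J) * a ord0 &
        c r = (ord0 \in J) * a ord0 + ((t \in J) * a t + Y)]%N.
  move=> big_in fit; have pack := packing 1 a c J (apart J) fit.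
  have rJ : r \in J by apply: big_in; lia.
  split=> [/pack ->|/pack ->|].
  - by rewrite big_pred0 // => j; rewrite !perm1 andbF.
  - rewrite (sum_split01 _ t) // !perm1 t1 /= andbT ltnn andbF mul0n add0n.
    rewrite big_pred0 ?addn0 // => j; rewrite perm1; lia.
  rewrite (pack r rJ) (sum_split01 _ t) // !perm1 tr (ltn_trans _ tr) ?t1 // !andbT.
  do 2!congr addn; apply: eq_bigl => j; rewrite perm1.
  by case: (ltnP 1 j) => j1; rewrite ?andbF // big_in ?andbT.
have [ct|ct] := leqP (c t + a t) (a ord0 + (a t + B)).
  have [c0|c0] := leqP (c ord0 + a ord0) (a ord0 + (a t + B)).
    have [||] := values setT.
    - by move=> j; rewrite inE.
    - move=> i _; rewrite sumT; have [->//|i0] := eqVneq i ord0.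
      have [->//|it] := eqVneq i t.
      by have := cS i; rewrite (negPf i0) (negPf it) !addn0.
    by rewrite !inE !mul1n => -> // -> // ->; rewrite !xpair_eqE !eqxx addnA eqxx.
  have [||] := values (setT :\ ord0).
  - by move=> j j1; rewrite !inE andbT -val_eqE /=; lia.
  - move=> i; rewrite !inE andbT => i0.
    have := @packing_peel _ 1 a c setT ord0 i (apart _) (in_setT _).
    rewrite sumT sumN0 !perm1 ltn0 !addn0; apply; rewrite ?inE //.
      by have := cS ord0; rewrite eqxx eq_sym (negPf t0); lia.
    have [->//|it] := eqVneq i t.
    by have := cS i; rewrite (negPf i0) (negPf it) !addn0.
  rewrite !inE eqxx t0 /= !mul0n !mul1n add0n => _ -> // ->.
  have -> : c ord0 = (a t + B).+1.
    by have := cS ord0; rewrite eqxx eq_sym (negPf t0); lia.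
  by rewrite eqxx !orbT.
have {ct}ct : c t = (a ord0 + B).+1.
  by have := cS t; rewrite eqxx (negPf t0); lia.
have fit i : i != t -> (c i + a i <= a ord0 + B + (i == ord0))%N.
  move=> it.
  have := @packing_peel _ 1 a c setT t i (apart _) (in_setT _).
  have -> : ((1%g : 'S_n.+1) i < (1%g : 'S_n.+1) t)%N = (i == ord0).
    by rewrite !perm1 t1 ltnS leqn0.
  rewrite sumT sumNt; apply; rewrite ?inE //.
    by rewrite ct; lia.
  by have := cS i; rewrite (negPf it) addn0.
have [c0|c0] := leqP (c ord0 + a ord0) (a ord0 + B).
  have [||] := values (setT :\ t).
  - by move=> j j1; rewrite !inE andbT -val_eqE /=; lia.
  - move=> i; rewrite !inE andbT sumNt => it.
    have [->//|i0] := eqVneq i ord0.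
    by have := fit i it; rewrite (negPf i0) addn0.
  rewrite !inE eqxx eq_sym t0 /= !mul0n !mul1n add0n => -> // _ ->.
  by rewrite ct eqxx !orbT.
have [||] := values (setT :\ t :\ ord0).
- by move=> j j1; rewrite !inE andbT -!val_eqE /=; lia.
- move=> i; rewrite !inE andbT sumN0t => /andP[i0 it].
  have := @packing_peel _ 1 a c (setT :\ t) ord0 i (apart _).
  rewrite sumNt sumN0t !perm1 ltn0 !addn0; apply; rewrite ?inE ?it 1?eq_sym ?t0 //.
    by have := fit ord0; rewrite eqxx eq_sym t0 => /(_ isT); lia.
  by rewrite eq_sym.
  by have := fit i it; rewrite (negPf i0) addn0.
rewrite !inE !eqxx t0 /= !mul0n !add0n => _ _ ->.
have -> : c ord0 = B.+1.
  by have := fit ord0; rewrite eqxx eq_sym t0 => /(_ isT); lia.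
by rewrite ct eqxx !orbT.
Qed.

(** In the coordinates (x_0, x_t, x_r), the first and third points have x_0 = 1,
    the third and fourth share the value T' of x_t, and x_r / x_0 has the same
    value rho at the second and fourth.  The vanishing quadratic is a sum of
    three products of two linear polynomials, each product covering the four
    points by two lines; the second and third products cancel the terms
    x_r x_t and x_r x_0 of the first. *)
Lemma second_layer_base :
  second_layer q a r t =
  q ^+ (2 * Y) *
  ((1 - q ^+ a ord0) * (1 - q ^+ a t) *
     ((1 - q ^+ (a ord0 + (a t + B)).+1) + q ^+ a t * (1 - q ^+ B.+1)) /
   ((1 - q ^+ B.+1) * (1 - q ^+ (a t + B).+1) * (1 - q ^+ (a ord0 + B).+1))) *
  (dyson_poly q 1 a)@_(dyson_mnm a).
Proof.
pose y := q ^+ Y; pose T := q ^+ a t; pose A0 := q ^+ a ord0; pose V := q ^+ B.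
have ne1 k : 1 - q ^+ k.+1 != 0.
  by rewrite subr_eq0 eq_sym -[1](expr0 q) (qpow_eq q q_inj).
have nV : 1 - q * V != 0 by rewrite -exprS.
have nVT : 1 - q * (T * V) != 0 by rewrite -exprD -exprS.
have nVA : 1 - q * (A0 * V) != 0 by rewrite -exprD -exprS.
have V0 : V != 0 := qpow_neq0 q q_inj B.
have q0 : q != 0 := q_neq0 q q_inj.
(* mu, mu' and mu'' are the slopes of the lines through the points 1 and 3
   (x_r against x_t), 1 and 2 (x_r against x_0), 2 and 4 (x_r against x_t);
   lam, lam' and lam'' are their intercepts. *)
pose mu := y * (T - 1) / (1 - q * V).
pose mu' := y * T * (A0 - 1) / (1 - q * (T * V)).
pose mu'' := y * (T - 1) / (1 - q * (A0 * V)).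
pose rho := y / (q * V).
pose lam := y * A0 * T - mu * A0.
pose lam' := y * A0 * T - mu'.
pose lam'' := y * T - mu''.
pose T' := V * A0 * q.
pose kap := mu * mu' + rho * mu'' - rho * mu.
have -> : second_layer q a r t = kap * (dyson_poly q 1 a)@_(dyson_mnm a).
  pose G : {mpoly K[n.+1]} := 'X_r ^+ 2 - kap *: 'X_[U_(ord0) + U_(t)].
  pose x i : {mpoly K[n.+1]} := 'X_i.
  pose G' : {mpoly K[n.+1]} :=
     (x r - rho%:MP * x ord0) * (x r - lam%:MP - mu%:MP * x t)
     + mu%:MP * (x r - lam'%:MP - mu'%:MP * x ord0) * (x t - T'%:MP)
     + rho%:MP * (x ord0 - 1) * (x r - lam''%:MP - mu''%:MP * x t).
  have : (dyson_poly q 1 a * G)@_(dyson_mnm a + U_(ord0) + U_(t)) = 0.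
    apply: (top_form_coef q q_inj 1 _ _ G G').
    - by rewrite !mdegD !mdeg1 leq_add2r addn1 msize_dyson_poly.
    - apply: leq_trans (msizeD_le _ _) _; rewrite msizeN geq_max.
      rewrite mpolyXn msizeX mdegMn mdeg1 /=.
      by apply: msize_monomial_le; rewrite mdegD !mdeg1.
    - have -> : G' - G = (- lam - mu * T' - rho) *: 'X_r
          + ((rho * lam + mu * mu' * T' - rho * lam'') *: 'X_ord0
          + ((rho * mu'' - mu * lam') *: 'X_t
          + (mu * lam' * T' + rho * lam'') *: 'X_[0])).
        rewrite /G' /G /kap mpolyX0 mpolyXD -!mul_mpolyC.
        by rewrite !(mpolyCD, mpolyCB, mpolyCN, mpolyCM) /x; ring.
      by do 3!(apply: msize_add_le; first by apply: msize_monomial_le; rewrite mdeg1);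
         apply: msize_monomial_le; rewrite mdeg0.
    move=> c cd; apply/eqP; rewrite mevalM mulf_eq0.
    have [//|/= nz] := eqVneq (dyson_poly q 1 a).@[_] 0.
    have := second_layer_points c nz cd; rewrite /G' /x.
    rewrite !(mevalB, mevalD, mevalM, mevalC, mevalXU, meval1).
    rewrite !inE => /or4P[] /eqP[-> -> ->];
      rewrite !(exprS, exprD, expr0) -/y -/T -/A0 -/V /lam /lam' /lam'' /T' /mu /mu' /mu'' /rho;
      apply/eqP; field; rewrite ?nV ?nVT ?nVA ?V0 ?q0 //.
  rewrite /G mulrBr mcoeffB -scalerAr mcoeffZ => /eqP; rewrite subr_eq0 => /eqP.
  rewrite /second_layer mulrC => ->; congr (_ * _).
  by rewrite -addmA addmC mcoeffMX.
congr (_ * _); rewrite /kap /mu /mu' /mu'' /rho.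
rewrite mulnC exprM !exprS !exprD -/y -/T -/A0 -/V.
by field; rewrite ?nV ?nVT ?nVA ?V0 ?q0.
Qed.

End Base.

(** * The constant term *)

Lemma linear_quotient (L : fieldType) (x y c d : L) :
  y != 0 -> 1 - x / y * c * d = (y - d * c * x) / y.
Proof. by move=> y0; field. Qed.

Section Value.
Context {K : fieldType} (q : K).
Hypothesis q_inj : injective (fun k : nat => q ^+ k).
Context {n : nat}.

(** Induction on t: passing t over k = t - 1 divides by q^a_k and turns the weight
    of a_k in the exponent L from 1 to 2, as k now lies between t and r. *)
Lemma second_layer_value (a : 'I_n.+1 -> nat) (r t : 'I_n.+1) :
  (1 <= t)%N -> (t < r)%N ->
  let A := (\sum_(i < n.+1 | (1 <= i)%N) a i)%N in
  let a0 := a ord0 in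
  let L := (2 * (\sum_(k < n.+1 | (t + 1 <= k <= r - 1)%N) a k)
            + \sum_(k < n.+1 | (1 <= k <= t - 1)%N) a k)%N in
  second_layer q a r t =
  q ^+ L *
  ((1 - q ^+ a0) * (1 - q ^+ a t) *
     ((1 - q ^+ (a0 + A + 1)) + q ^+ a t * (1 - q ^+ (A + 1 - a t))) /
   ((1 - q ^+ (A + 1 - a t)) * (1 - q ^+ (A + 1)) *
      (1 - q ^+ (a0 + A + 1 - a t)))) *
  (qpoch q q (A + a0) / \prod_(i < n.+1) qpoch q q (a i)).
Proof.
move=> t_gt0 tr /=; have [k tk] : exists k, t = k.+1 :> nat.
  by exists t.-1; rewrite prednK.
elim: k => [|k IHk] in a t tk t_gt0 tr *.
  rewrite (second_layer_base q q_inj a r t tk tr) (qDyson_coef q q_inj).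
  pose B := (\sum_(j < n.+1 | (1 < j)%N) a j)%N.
  have sumA : (\sum_(i < n.+1 | (1 <= i)%N) a i = a t + B)%N.
    rewrite (sum_split01 _ t) // tk /= mul0n mul1n add0n; congr addn.
    by apply: eq_bigl => j; lia.
  have sumT : (\sum_i a i = a t + B + a ord0)%N.
    by rewrite -sumA addnC (bigD1 ord0) //=; congr addn; apply: eq_bigl => j; rewrite lt0n.
  rewrite sumT sumA -/B; congr (q ^+ _ * (_ / _) * _).
  - rewrite tk [X in (_ + X)%N]big_pred0 => [|j]; last by lia.
    by rewrite addn0; congr muln; apply: eq_bigl => j; lia.
  - by congr (_ * (_ - q ^+ _ + _ * (_ - q ^+ _))); lia.
  - by congr ((_ - q ^+ _) * (_ - q ^+ _) * (_ - q ^+ _)); lia.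
have lt_p : (k.+1 < n.+1)%N by have := ltn_ord t; lia.
pose p : 'I_n.+1 := Ordinal lt_p; pose s := tperm p t.
have tp : t = p.+1 :> nat by [].
apply: (mulfI (qpow_neq0 q q_inj (a p))).
rewrite (second_layer_swap q q_inj a r p t) // -/s.
rewrite (IHk (a \o s) p) //=; last by lia.
have s0 : s ord0 = ord0 by rewrite tpermD // -val_eqE /=; lia.
have st : s p = t by rewrite tpermL.
have fix_s (j : 'I_n.+1) : (j != p :> nat) -> (j != t :> nat) -> s j = j.
  by move=> jp jt; rewrite tpermD // eq_sym -val_eqE.
have -> : (\sum_(i < n.+1 | (1 <= i)%N) a (s i) = \sum_(i < n.+1 | (1 <= i)%N) a i)%N.
  rewrite [RHS](reindex_perm s); apply: eq_bigl => i.
  by rewrite !lt0n !(inj_eq val_inj i ord0) -(inj_eq (@perm_inj _ s)) s0.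
have -> : \prod_(i < n.+1) qpoch q q (a (s i)) = \prod_(i < n.+1) qpoch q q (a i).
  by rewrite [RHS](reindex_perm s).
rewrite s0 st [RHS]mulrA [q ^+ a p * _]mulrA -exprD; congr (q ^+ _ * _ * _).
rewrite (bigD1 t) /=; last by lia.
have -> : s t = p by rewrite tpermR.
rewrite [X in _ = (_ + (_ + X))%N](bigD1 p) /=; last by lia.
have -> : (\sum_(i < n.+1 | (k.+1 + 1 <= i <= r - 1) && (i != t)) a (s i)
   = \sum_(i < n.+1 | t + 1 <= i <= r - 1) a i)%N.
  apply: eq_big => [i|i /andP[ir]]; rewrite -val_eqE /=; first by lia.
  by move=> it; rewrite fix_s //=; lia.
have -> : (\sum_(i < n.+1 | 1 <= i <= k.+1 - 1) a (s i)
   = \sum_(i < n.+1 | (1 <= i <= t - 1) && (i != p)) a i)%N.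
  apply: eq_big => [i|i ik]; first by rewrite -val_eqE /=; lia.
  by rewrite fix_s //=; lia.
ring. 
Qed.

(** For each ordered pair (i, j) the q-Pochhammer symbol with a_i factors is a
    product of linear polynomials over x_j^a_i, whichever index is smaller; the
    exponents of x_j add up to sigma - a_j. *)
Lemma qDyson_tofrac (a : 'I_n.+1 -> nat) :
  qDyson q a = tofrac (dyson_poly q 1 a) / tofrac 'X_[dyson_mnm a].
Proof.
pose phi (i j : 'I_n.+1) : {mpoly K[n.+1]} :=
  \prod_(u < a i) ('X_j - q ^+ (u + (j < i)%N) *: 'X_i).
pose psi i j := tofrac (phi i j) / xvar K n j ^+ a i.
have x0 i : xvar K n i != 0 by apply: tofracX_neq0.
have psiE z i j : z = xvar K n i / xvar K n j * cst n (q ^+ (j < i)%N) ->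
    qpoch (cst n q) z (a i) = psi i j.
  move=> ->; rewrite /psi /phi rmorph_prod /=.
  have -> : xvar K n j ^+ a i = \prod_(u < a i) xvar K n j.
    by rewrite prodr_const card_ord.
  rewrite -prodf_div; apply: eq_bigr => u _.
  rewrite rmorphB /= -mul_mpolyC rmorphM /= -/(xvar K n j) -/(xvar K n i).
  rewrite exprD mpolyCM rmorphM /= !rmorphXn /= -/(cst n q).
  have -> : cst n (q ^+ (j < i)) = cst n q ^+ (j < i) by rewrite /cst !rmorphXn.
  exact: linear_quotient (x0 j).
have -> : qDyson q a = \prod_i \prod_(j | j != i) psi i j.
  rewrite /qDyson (eq_bigr (fun i : 'I_n.+1 =>
    (\prod_(j < n.+1 | (i < j)%N) psi i j) * \prod_(j < n.+1 | (i < j)%N) psi j i)).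
    rewrite big_split /= [X in _ * X](exchange_big_dep xpredT) //= -big_split /=.
    apply: eq_bigr => i _; rewrite [RHS](bigID (fun j : 'I_n.+1 => (i < j)%N)) /=.
    by congr (_ * _); apply: eq_bigl => j; rewrite -val_eqE /=; lia.
  move=> i _; rewrite -big_split; apply: eq_bigr => j ij /=; congr (_ * _).
    by apply: psiE; rewrite ltnNge (ltnW ij) expr0 /cst mpolyC1 tofrac1 mulr1.
  by apply: psiE; rewrite ij expr1.
under eq_bigr do rewrite prodf_div.
rewrite prodf_div; congr (_ / _).
  by rewrite /dyson_poly rmorph_prod /=; apply: eq_bigr => i _; rewrite rmorph_prod /=;
     apply: eq_bigr => j _; rewrite !perm1.
rewrite (exchange_big_dep xpredT) //= mpolyXE_id rmorph_prod /=.
apply: eq_bigr => j _; rewrite rmorphXn /= mnmE prodrXr; congr (_ ^+ _).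
rewrite [in RHS](bigD1 j) //= addKn; by apply: eq_bigl => i; rewrite eq_sym.
Qed.

Lemma CT_second_layer (a : 'I_n.+1 -> nat) (r t : 'I_n.+1) :
  CT (xvar K n r ^+ 2 / (xvar K n ord0 * xvar K n t) * qDyson q a)
  = second_layer q a r t.
Proof.
rewrite qDyson_tofrac mulf_div -!tofracXn -!tofracM.
rewrite /second_layer -CTE; congr (CT (_ / tofrac _)).
by rewrite !mpolyXD mulrC mulrA.
Qed.

End Value.

Lemma qvar_pow_inj (F : fieldType) : injective (fun k : nat => qvar F ^+ k).
Proof.
move=> k l /eqP; rewrite /qvar -!tofracXn tofrac_eq => /eqP /(congr1 (size \o polyseq)) /=.
by rewrite !size_polyXn => -[].
Qed.

Theorem corollary1p5 (F : fieldType) (n : nat) (hn : (2 <= n)%N)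
    (a : 'I_n.+1 -> nat) (r t : 'I_n.+1) (ht : (1 <= t)%N) (htr : (t < r)%N) :
  let K := Fq F in
  let q := qvar F in
  let x := xvar K n in
  let A := (\sum_(i < n.+1 | (1 <= i)%N) a i)%N in
  let a0 := a ord0 in
  let L := (2 * (\sum_(k < n.+1 | (t + 1 <= k <= r - 1)%N) a k)
            + \sum_(k < n.+1 | (1 <= k <= t - 1)%N) a k)%N in
  CT (x r ^+ 2 / (x ord0 * x t) * qDyson q a) =
  q ^+ L *
  ((1 - q ^+ a0) * (1 - q ^+ a t) *
     ((1 - q ^+ (a0 + A + 1)) + q ^+ a t * (1 - q ^+ (A + 1 - a t))) /
   ((1 - q ^+ (A + 1 - a t)) * (1 - q ^+ (A + 1)) *
      (1 - q ^+ (a0 + A + 1 - a t)))) *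
  (qpoch q q (A + a0) / \prod_(i < n.+1) qpoch q q (a i)).
Proof.
move=> K q x A a0 L; rewrite CT_second_layer.
exact: (second_layer_value q (@qvar_pow_inj F)).
Qed.
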